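(* Let $Y\subset\mathbb{R}^m$ be convex and compact, and let $\varphi(x,y)$ be a real-valued function of $x\in\mathbb{R}^n$ and $y$ such that $\varphi(\cdot,y)$ is differentiable for every fixed $y\in Y$, both $\varphi(\cdot,\cdot)$ and $\nabla_x\varphi(\cdot,\cdot)$ are jointly continuous, and $\varphi(x,\cdot)$ is concave for every fixed $x$. Define $f(x)=\max_{y\in Y}\varphi(x,y)$, let $Y^*(x)$ be the solution set of this maximization problem, let $S(x)=\{\nabla_x\varphi(x,y)\mid y\in Y^*(x)\}$, and for $\epsilon>0$ let $$Y^\epsilon(x)=\operatorname{argmax}_{y\in Y}\Big\{\varphi(x,y)-\frac{\epsilon}{2}\|\nabla_x\varphi(x,y)\|^2\Big\},\qquad G(x,\epsilon)=\{\nabla_x\varphi(x,y)\mid y\in Y^\epsilon(x)\}.$$ Let $y^\epsilon:\mathbb{R}^n\to\mathbb{R}^m$ be a single-valued map satisfying $y^\epsilon(x)\in Y^\epsilon(x)$ for all $(x,\epsilon)\in\mathbb{R}^n\times(0,+\infty)$. Then for any fixed $\bar x\in\mathbb{R}^n$, the following properties hold: (a) $\lim_{\epsilon\downarrow0,\,x\to\bar x}\varphi(x,y^\epsilon(x))=f(\bar x)$. (b) $\limsup_{\epsilon\downarrow0,\,x\to\bar x}\nabla_x\varphi(x,y^\epsilon(x))\subset\partial f(\bar x)$. Consequently, the map $G$ satisfies $\limsup_{\epsilon\downarrow0,\,x\to\bar x}G(x,\epsilon)\subset\partial f(\bar x)$. (c) For any $\epsilon>0$, $\limsup_{x\to\bar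 x}\nabla_x\varphi(x,y^\epsilon(x))\subset\{\nabla_x\varphi(\bar x,y)\mid y\in Y^\epsilon(\bar x)\}$. Consequently, $G$ satisfies $\limsup_{x\to\bar x}G(x,\epsilon)=G(\bar x,\epsilon)$ for all $\epsilon>0$. (d) If $S(\bar x)$ is a convex set, then $\lim_{\epsilon\downarrow0}\nabla_x\varphi(\bar x,y^\epsilon(\bar x))=\operatorname{argmin}_{v\in\partial f(\bar x)}\|v\|$, and $G$ also satisfies $\lim_{\epsilon\downarrow0}G(\bar x,\epsilon)=\operatorname{argmin}_{v\in\partial f(\bar x)}\|v\|$. Thus, $G$ is a descent-oriented subdifferential for $f$.
   Context: $\|\cdot\|$ is the Euclidean norm; $\mathbb{N}=\{0,1,2,\dots\}$. Under the stated hypotheses $f$ is locally Lipschitz continuous; $\partial f$ is its Clarke subdifferential. A single-valued map is treated as a singleton-valued set-valued map. Set limits (Painlevé–Kuratowski). For a sequence of sets $\{C^k\}$ in $\mathbb{R}^n$, the outer limit $\limsup_{k\to+\infty}C^k$ is the set of all $u$ for which there are an infinite $N\subset\mathbb{N}$ and $u^k\in C^k$ ($k\in N$) with $u^k\to u$ as $k\to\infty$, $k\in N$; the inner limit $\liminf_{k\to+\infty}C^k$ is defined in the same way with $N\subset\mathbb{N}$ having finite complement. If the two coincide, their common value is $\lim_{k\to+\infty}C^k$. For sets $A_\epsilon$ ($\epsilon>0$), $\lim_{\epsilon\downarrow0}A_\epsilon=C$ means $\lim_{k\to+\infty}A_{\epsilon_k}=C$ for every sequence $\epsilon_k>0$ with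 $\epsilon_k\to0$. For $G:\mathbb{R}^n\times(0,+\infty)\rightrightarrows\mathbb{R}^n$: $\limsup_{x\to\bar x}G(x,\epsilon)$ ($\epsilon$ fixed) is the union of $\limsup_{k\to+\infty}G(x^k,\epsilon)$ over all sequences $x^k\to\bar x$ ($x^k=\bar x$ is allowed); $\limsup_{\epsilon\downarrow0,\,x\to\bar x}G(x,\epsilon)$ is the union of $\limsup_{k\to+\infty}G(x^k,\epsilon_k)$ over all sequences $x^k\to\bar x$ and $\epsilon_k>0$ with $\epsilon_k\to0$. Definition. For a locally Lipschitz $f:\mathbb{R}^n\to\mathbb{R}$, a map $G:\mathbb{R}^n\times(0,+\infty)\rightrightarrows\mathbb{R}^n$ is a descent-oriented subdifferential for $f$ if for each fixed $\epsilon>0$ the mapping $G(\cdot,\epsilon)$ is closed-valued and locally bounded (every $\bar x$ has a neighborhood $V$ with $\bigcup_{x\in V}G(x,\epsilon)$ bounded), and for all $\bar x\in\mathbb{R}^n$: (G1) $\limsup_{\epsilon\downarrow0,\,x\to\bar x}G(x,\epsilon)\subset\partial f(\bar x)$; (G2) $\lim_{\epsilon\downarrow0}\big(\limsup_{x\to\bar x}G(x,\epsilon)\big)=\operatorname{argmin}_{v\in\partial f(\bar x)}\|v\|$ (the singleton consisting of the minimal norm element of $\partial f(\bar x)$). The two conditions $\limsup_{x\to\bar x}G(x,\epsilon)=G(\bar x,\epsilon)$ for all $\epsilon>0$, and $\lim_{\epsilon\downarrow0}G(\bar x,\epsilon)=\operatorname{argmin}_{v\in\partial f(\bar x)}\|v\|$,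 holding for all $\bar x$, are together sufficient for (G2). *)

(* Defs.v *)
From HB Require Import structures.
From mathcomp Require Import all_boot all_order all_algebra.
From mathcomp Require Import all_classical all_reals all_analysis.

Set Implicit Arguments.
Unset Strict Implicit.
Unset Printing Implicit Defensive.

Import Order.TTheory GRing.Theory Num.Theory.
Import numFieldNormedType.Exports.

Local Open Scope classical_set_scope.
Local Open Scope ring_scope.

(* The topology of 'rV[R]_n comes from the sup norm `|_|, which induces the
   usual topology of R^n; wherever the value of a norm matters, the Euclidean
   norm [enorm] is used instead. *)
Section Euclidean.
Context {R : realType} {n : nat}.
Implicit Types u v x : 'rV[R]_n.

Definition dotv u v : R := \sum_i u 0 i * v 0 i.

Definition enorm v : R := Num.sqrt (dotv v v).

Definition grad (f : 'rV[R]_n -> R) x : 'rV[R]_n :=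
  \row_i 'D_(delta_mx 0 i) f x.

End Euclidean.

Definition argmin {R : realType} {T : Type} (A : set T) (F : T -> R) : set T :=
  [set v | A v /\ forall w, A w -> F v <= F w].

Definition argmax {R : realType} {T : Type} (A : set T) (F : T -> R) : set T :=
  [set v | A v /\ forall w, A w -> F w <= F v].

Section SetLimits.
Context {R : realType} {n : nat}.
Implicit Types (C : nat -> set 'rV[R]_n) (L : set 'rV[R]_n).

(* The terms u k with k outside N are irrelevant. *)
Definition outer_limit C : set 'rV[R]_n :=
  [set v | exists N : set nat, infinite_set N /\
    exists u : nat -> 'rV[R]_n,
      (forall k, N k -> C k (u k)) /\ u k @[k --> within N \oo] --> v].

Definition inner_limit C : set 'rV[R]_n :=
  [set v | exists N : set nat, finite_set (~` N) /\
    exists u : nat -> 'rV[R]_n,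
      (forall k, N k -> C k (u k)) /\ u k @[k --> within N \oo] --> v].

Definition set_cvg C L : Prop := outer_limit C = L /\ inner_limit C = L.

(* Families indexed by eps > 0 are total functions of eps : R; only their
   values at positive eps are ever used. *)
Definition set_cvg_eps (A : R -> set 'rV[R]_n) L : Prop :=
  forall e : nat -> R, (forall k, 0 < e k) -> e @ \oo --> (0 : R) ->
    set_cvg (fun k => A (e k)) L.

Definition limsup_x (H : 'rV[R]_n -> set 'rV[R]_n) (xbar : 'rV[R]_n) :
    set 'rV[R]_n :=
  [set v | exists2 x : nat -> 'rV[R]_n,
    x @ \oo --> xbar & outer_limit (fun k => H (x k)) v].

Definition limsup_eps_x (G : 'rV[R]_n -> R -> set 'rV[R]_n) (xbar : 'rV[R]_n) :
    set 'rV[R]_n :=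
  [set v | exists (x : nat -> 'rV[R]_n) (e : nat -> R),
    [/\ x @ \oo --> xbar, forall k, 0 < e k, e @ \oo --> (0 : R)
      & outer_limit (fun k => G (x k) (e k)) v]].

End SetLimits.

Section Subdifferentials.
Context {R : realType} {n : nat}.
Implicit Types (f : 'rV[R]_n -> R) (x v : 'rV[R]_n).

Definition locally_lipschitz f : Prop :=
  forall x, exists2 V, nbhs x V & [lipschitz (f z : R^o) | z in V].

(* limsup of (f (z + t v) - f z) / t as z -> x and t decreases to 0 *)
Definition clarke_dd f x v : \bar R :=
  limf_esup (fun p : 'rV[R]_n * R => ((f (p.1 + p.2 *: v) - f p.1) / p.2)%:E)
    (filter_prod (nbhs x) (0 : R)^'+).

Definition clarke f x : set 'rV[R]_n :=
  [set xi | forall v, ((dotv xi v)%:E <= clarke_dd f x v)%E].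

Definition min_norm_subgrad f x : set 'rV[R]_n := argmin (clarke f x) enorm.

Record descent_oriented f (G : 'rV[R]_n -> R -> set 'rV[R]_n) : Prop :=
  DescentOriented {
    do_lipschitz : locally_lipschitz f;
    do_closed : forall e, 0 < e -> forall x, closed (G x e);
    do_bounded : forall e, 0 < e -> forall x,
      exists2 V, nbhs x V & bounded_set (\bigcup_(z in V) G z e);
    do_G1 : forall x, limsup_eps_x G x `<=` clarke f x;
    do_G2 : forall x,
      set_cvg_eps (fun e => limsup_x (G^~ e) x) (min_norm_subgrad f x)
  }.

End Subdifferentials.

Section MaxFunction.
Context {R : realType} {n m : nat}.
Variables (Y : set 'rV[R]_m) (phi : 'rV[R]_n -> 'rV[R]_m -> R).

Definition gradx (x : 'rV[R]_n) (y : 'rV[R]_m) : 'rV[R]_n := grad (phi^~ y) x.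

(* The supremum is attained as soon as Y is nonempty and compact and phi x is
   continuous on Y. *)
Definition maxf (x : 'rV[R]_n) : R := sup [set phi x y | y in Y].

Definition Ystar (x : 'rV[R]_n) : set 'rV[R]_m := argmax Y (phi x).

Definition activegrads (x : 'rV[R]_n) : set 'rV[R]_n :=
  [set gradx x y | y in Ystar x].

Definition Yeps (x : 'rV[R]_n) (e : R) : set 'rV[R]_m :=
  argmax Y (fun y => phi x y - e / 2 * enorm (gradx x y) ^+ 2).

Definition Geps (x : 'rV[R]_n) (e : R) : set 'rV[R]_n :=
  [set gradx x y | y in Yeps x e].

End MaxFunction.

(* Main.v *)
Require Import Defs.
From HB Require Import structures.
From mathcomp Require Import all_boot all_order all_algebra.
From mathcomp Require Import all_classical all_reals all_analysis.
From mathcomp Require Import ring lra.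

Set Implicit Arguments.
Unset Strict Implicit.
Unset Printing Implicit Defensive.

Import Order.TTheory GRing.Theory Num.Theory.
Import numFieldNormedType.Exports.

Local Open Scope classical_set_scope.
Local Open Scope ring_scope.

(** The whole proof is one compactness argument, run along ultrafilters instead
    of subsequences: on an ultrafilter a selection with values in the compact
    set Y converges, and a filter contains every set that belongs to all finer
    ultrafilters ([near_ultra], [cvg_ultra]).

    The objective phi x y - e/2 |grad_x phi x y|^2 is jointly continuous in
    (x, e, y), so the graph of its argmax is closed, up to and including e = 0,
    where the argmax is the set of active indices ([Yeps_closed_graph],
    [Yeps0]).  Hence maximizers along x -> xbar, e -> ebar accumulate only at
    maximizers for (xbar, ebar), and their gradients at elements of
    G xbar ebar ([Yeps_ultra_limit], [Geps_closed_graph]).  The case ebar = 0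
    gives (a), and also (b), because every active gradient is a Clarke
    subgradient: f dominates phi _ y and touches it at xbar ([active_clarke]).
    The case of constant e > 0 gives (c).

    For (d), comparing the two optimality conditions shows that a gradient in
    G x e is never longer than an active gradient ([Yeps_enorm_le]), so the
    limits as e -> 0 are active gradients of minimal norm
    ([Geps_ultra_argmin]).  When the active gradients form a convex set S,
    that minimizer s0 is unique, and it remains to see that it is also
    minimal in the Clarke subdifferential.  By the mean value theorem, the
    Clarke directional derivative in the direction v is at most the maximum of
    <s, v> over s in S ([clarke_dd_le]); for v = - s0 convexity bounds that maximum by - |s0|^2, so
    every Clarke subgradient xi satisfies <xi, s0> >= |s0|^2
    ([clarke_dotv_ge]), which forces |xi| >= |s0| with equality only at s0. *)

(** * Convergence tested on ultrafilters *)

(** If A is not in F, adding its complement to F gives a proper filter, and an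
    ultrafilter finer than that one excludes A. *)
Lemma near_ultra (T : Type) (F : set_system T) (A : set T) : Filter F ->
  (forall U, UltraFilter U -> F `<=` U -> U A) -> F A.
Proof.
move=> FF ultraA; apply: contrapT => nFA.
have FnA : ProperFilter (within (~` A) F).
  apply: Build_ProperFilter => B0; apply: nFA.
  by apply: (filterS _ (B0 : F _)) => t nAt; apply: contrapT => /nAt.
have [U [UU FU]] := ultraFilterLemma FnA.
have UA : U A.
  apply: ultraA => B FB; apply: FU.
  by apply: filterS (FB : F _) => t Bt _.
have UnA : U (~` A) by apply: FU; exact: (filterE (F := F)).
by have [t []] := filter_ex (filterI UA UnA).
Qed.

Lemma cvg_ultra (T : Type) (F : set_system T) (X : topologicalType)
    (f : T -> X) (a : X) : Filter F ->
  (forall U, UltraFilter U -> F `<=` U -> f @ U --> a) -> f @ F --> a.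
Proof.
move=> FF Uf B aB; apply: (@near_ultra _ F (f @^-1` B)) => U UU FU.
exact: (Uf U UU FU B aB).
Qed.

Lemma cvg_finer (T : Type) (F U : set_system T) (X : topologicalType)
    (f : T -> X) (a : X) : F `<=` U -> f @ F --> a -> f @ U --> a.
Proof. by move=> FU fa B /fa; exact: FU. Qed.

Lemma within_continuous_cvg (T : Type) (F : set_system T)
    (X Z : topologicalType) (A : set X) (f : X -> Z) (p : T -> X) (a : X) :
  Filter F -> {within A, continuous f} -> A a -> p @ F --> a ->
  (\forall t \near F, A (p t)) -> f (p t) @[t --> F] --> f a.
Proof.
move=> FF /subspace_continuousP fA Aa pa FA B /(fA _ Aa) /pa FB.
suff: \forall t \near F, B (f (p t)) by [].
by apply: filterS2 (FB : F _) FA => t BAt At; exact: BAt.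
Qed.

(** * The Euclidean inner product *)

Section Inner.
Context {R : realType} {n : nat}.
Implicit Types u v w : 'rV[R]_n.

Lemma dotvC u v : dotv u v = dotv v u.
Proof. by apply: eq_bigr => i _; rewrite mulrC. Qed.

Lemma dotvDl u v w : dotv (u + v) w = dotv u w + dotv v w.
Proof. by rewrite -big_split; apply: eq_bigr => i _; rewrite mxE mulrDl. Qed.

Lemma dotvZl a u v : dotv (a *: u) v = a * dotv u v.
Proof. by rewrite mulr_sumr; apply: eq_bigr => i _; rewrite mxE mulrA. Qed.

Lemma dotvDr u v w : dotv w (u + v) = dotv w u + dotv w v.
Proof. by rewrite !(dotvC w) dotvDl. Qed.

Lemma dotvZr a u v : dotv v (a *: u) = a * dotv v u.
Proof. by rewrite !(dotvC v) dotvZl. Qed.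

Lemma dotvNl u v : dotv (- u) v = - dotv u v.
Proof. by rewrite -scaleN1r dotvZl mulN1r. Qed.

Lemma dotvNr u v : dotv u (- v) = - dotv u v.
Proof. by rewrite !(dotvC u) dotvNl. Qed.

Lemma dotv_ge0 u : 0 <= dotv u u.
Proof. by apply: sumr_ge0 => i _; rewrite -expr2 sqr_ge0. Qed.

Lemma enorm_sqr u : enorm u ^+ 2 = dotv u u.
Proof. by rewrite sqr_sqrtr // dotv_ge0. Qed.

Lemma ler_enorm u v : (enorm u <= enorm v) = (dotv u u <= dotv v v).
Proof. by rewrite ler_sqrt // dotv_ge0. Qed.

Lemma dotv_eq0 u : dotv u u = 0 -> u = 0.
Proof.
move=> u0; apply/rowP => i; rewrite mxE; apply/eqP.
have := @psumr_eq0P _ _ xpredT _ (fun i _ => sqr_ge0 (u 0 i)) u0 i isT.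
by move/eqP; rewrite sqrf_eq0.
Qed.

Lemma dotv_cvg (T : Type) (F : set_system T) (u v : T -> 'rV[R]_n) a b :
  Filter F -> u @ F --> a -> v @ F --> b ->
  dotv (u t) (v t) @[t --> F] --> dotv a b.
Proof.
move=> FF ua vb; rewrite /dotv; apply: cvg_big => [|i _].
- exact: add_continuous.
- apply: cvgM; first exact: (cvg_comp _ _ ua (@coord_continuous R 1 n 0 i _)).
  exact: (cvg_comp _ _ vb (@coord_continuous R 1 n 0 i _)).
Qed.

Lemma normr_coord_le u i : `|u 0 i| <= `|u|.
Proof.
by rewrite [leRHS]/Num.Def.normr/= mx_normrE (le_bigmax _ _ (ord0, i)).
Qed.

Lemma dotv_le_norm u v : dotv u v <= n%:R * `|u| * `|v|.
Proof.
apply: (@le_trans _ _ (\sum_(i < n) `|u| * `|v|)).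
  apply: ler_sum => i _; apply: le_trans (ler_norm _) _.
  by rewrite normrM ler_pM // normr_coord_le.
by rewrite sumr_const card_ord -mulrA mulr_natl.
Qed.

(** First-order condition for the projection of 0 on C: otherwise a short step
    from a towards b would decrease the norm. *)
Lemma convex_min_norm (C : set 'rV[R]_n) a b :
  convex_set C -> argmin C enorm a -> C b -> dotv a a <= dotv b a.
Proof.
move=> Cc [Ca amin] Cb.
have seg t : 0 <= t <= 1 -> C (t *: b + (1 - t) *: a).
  move=> t01.
  have /= := Cc b a (Itv01 (proj1 (andP t01)) (proj2 (andP t01)))
    (mem_set Cb) (mem_set Ca).
  by move/set_mem.
rewrite leNgt; apply/negP => lt_ba.
set d := dotv a a - dotv b a.
have d0 : 0 < d by rewrite subr_gt0.
set c := dotv (b - a) (b - a).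
have expand t : dotv (t *: b + (1 - t) *: a) (t *: b + (1 - t) *: a)
    = dotv a a - 2 * t * d + t ^+ 2 * c.
  have -> : t *: b + (1 - t) *: a = a + t *: (b - a).
    by rewrite scalerBl scalerBr scale1r addrCA.
  have dE : d = - dotv (b - a) a by rewrite dotvDl dotvNl opprB.
  rewrite !dotvDl !dotvDr !dotvZl !dotvZr -/c (dotvC a (b - a)).
  by rewrite dE; ring.
have c0 : 0 <= c by exact: dotv_ge0.
(* The squared norm changes by - 2 t d + t^2 c; any t in ]0, 1] with t c <= d
   makes this negative. *)
set t := d / (d + c).
have dc0 : 0 < d + c by rewrite ltr_wpDr.
have t0 : 0 < t by rewrite divr_gt0.
have t1 : t <= 1 by rewrite ler_pdivrMr // mul1r lerDl.
have := amin _ (seg t _); rewrite t1 ltW // ler_enorm expand => /(_ isT).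
have tc : t * c <= d.
  by rewrite /t mulrAC ler_pdivrMr // mulrDr lerDr mulr_ge0// ltW.
have : t * (t * c) <= t * d by rewrite ler_pM2l.
have : 0 < t * d by rewrite mulr_gt0.
rewrite -/d; nra.
Qed.

(** If b lies beyond the hyperplane through a orthogonal to a, the excess of
    |b|^2 over |a|^2 controls the distance from b to a.  So a is the only point
    of least norm in that half-space, as the next two lemmas record. *)
Lemma dotv_sub_le (a b : 'rV[R]_n) :
  dotv a a <= dotv b a ->
  dotv (b - a) (b - a) <= dotv b b - dotv a a.
Proof.
move=> ab; rewrite dotvDl !dotvDr !dotvNl !dotvNr (dotvC a b); lra.
Qed.

Lemma enorm_le_of_dotv (a b : 'rV[R]_n) :
  dotv a a <= dotv b a -> enorm a <= enorm b.
Proof.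
move=> ab; rewrite ler_enorm -subr_ge0.
exact: le_trans (dotv_ge0 _) (dotv_sub_le ab).
Qed.

Lemma eq_of_enorm_le (a b : 'rV[R]_n) :
  dotv a a <= dotv b a -> enorm b <= enorm a -> b = a.
Proof.
rewrite ler_enorm -[_ <= dotv a a]subr_le0 => ab ba.
apply/subr0_eq/dotv_eq0/le_anti.
by rewrite dotv_ge0 andbT (le_trans (dotv_sub_le ab)).
Qed.

End Inner.

(** * Painleve-Kuratowski limits *)

Section SetLimits.
Context {R : realType} {n : nat}.

Lemma within_infinite_proper (N : set nat) :
  infinite_set N -> ProperFilter (within N \oo).
Proof.
move=> Ninf; apply: Build_ProperFilter => -[M _ NM]; apply: Ninf.
apply: (@sub_finite_set _ _ `I_M); last exact: finite_II.
by move=> k Nk /=; rewrite ltnNge; apply/negP => /NM /(_ Nk).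
Qed.

(** When N is finite the filter [within N \oo] is improper and the hypothesis
    holds trivially, so selections along arbitrary index sets can be treated
    uniformly. *)
Lemma set_cvg_singleton (C : nat -> set 'rV[R]_n) (s : 'rV[R]_n) :
  (forall k, C k !=set0) ->
  (forall (N : set nat) (u : nat -> 'rV[R]_n), (forall k, N k -> C k (u k)) ->
    u @ within N \oo --> s) ->
  set_cvg C [set s].
Proof.
move=> Cne Cs; split; apply/seteqP; split => v.
- move=> [N [Ninf [u [Cu uv]]]]; have NP := within_infinite_proper Ninf.
  exact: (cvg_unique (@norm_hausdorff _ _) uv (Cs _ _ Cu)).
- move=> ->; have [u Cu] := choice Cne.
  exists setT; split; first exact: infinite_nat.
  exists u; split => [k _|]; first exact: Cu.
  by apply: Cs => k _; exact: Cu.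
- move=> [N [Nfin [u [Cu uv]]]].
  have Ninf : infinite_set N.
    move=> Nf; apply: infinite_nat; rewrite -(setUv N).
    by rewrite finite_setU.
  have NP := within_infinite_proper Ninf.
  exact: (cvg_unique (@norm_hausdorff _ _) uv (Cs _ _ Cu)).
- move=> ->; have [u Cu] := choice Cne.
  exists setT; split; first by rewrite setCT.
  exists u; split => [k _|]; first exact: Cu.
  by apply: Cs => k _; exact: Cu.
Qed.

Lemma eq_set_cvg_eps (A B : R -> set 'rV[R]_n) (L : set 'rV[R]_n) :
  (forall e, 0 < e -> A e = B e) -> set_cvg_eps A L -> set_cvg_eps B L.
Proof.
move=> AB AL e e0 e_cvg.
have <- : (fun k => A (e k)) = (fun k => B (e k)).
  by apply/funext => k; exact: AB.
exact: AL.
Qed.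

Lemma limsup_x_ge (H : 'rV[R]_n -> set 'rV[R]_n) x : H x `<=` limsup_x H x.
Proof.
move=> v Hv; exists (fun=> x); first exact: cvg_cst.
exists setT; split; first exact: infinite_nat.
by exists (fun=> v); split=> //; exact: cvg_cst.
Qed.

End SetLimits.

(** * Differentiable functions along a line *)

Section Gradient.
Context {R : realType} {n : nat}.
Implicit Types (h : 'rV[R]_n -> R) (x z v : 'rV[R]_n).

Lemma derive_grad h x v : differentiable (h : _ -> R^o) x ->
  'D_v h x = dotv (grad h x) v.
Proof.
move=> dh; have hE u : 'D_u h x = 'd (h : _ -> R^o) x u by exact: deriveE.
rewrite hE {1}[v]row_sum_delta linear_sum /=; apply: eq_bigr => i _.
by rewrite linearZ /= mxE hE mulrC.
Qed.

Lemma is_derive_line h z v s : differentiable (h : _ -> R^o) (z + s *: v) ->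
  is_derive s 1 (fun r => h (z + r *: v)) (dotv (grad h (z + s *: v)) v).
Proof.
move=> dh; rewrite -derive_grad //.
have E : (fun r => r^-1 *: (((fun r => h (z + r *: v)) \o shift s) (r *: 1)
      - h (z + s *: v)))
    = (fun r => r^-1 *: ((h \o shift (z + s *: v)) (r *: v) - h (z + s *: v))).
  apply/funext => r /=; congr (_ *: (h _ - _)).
  by rewrite scalerDl scaler1 addrCA.
have dhv : derivable (h : _ -> R^o) (z + s *: v) v by exact: diff_derivable.
by apply: DeriveDef; rewrite ?/derivable ?/derive E.
Qed.

Lemma mvt_line h z v t : 0 < t ->
  (forall x, differentiable (h : _ -> R^o) x) ->
  exists2 c, 0 < c < t &
    h (z + t *: v) - h z = t * dotv (grad h (z + c *: v)) v.
Proof.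
move=> t0 dh.
have dg s := is_derive_line (dh (z + s *: v)).
have [|c ct hc] := @MVT _ (fun r => h (z + r *: v)) _ _ _ t0 (fun s _ => dg s).
  apply: continuous_subspaceT => s.
  by apply: differentiable_continuous; apply/derivable1_diffP; case: (dg s).
rewrite scale0r addr0 subr0 mulrC in hc; rewrite in_itv in ct.
by exists c.
Qed.

Lemma slope_line h x v : differentiable (h : _ -> R^o) x ->
  (h (x + t *: v) - h x) / t @[t --> 0^'+] --> dotv (grad h x) v.
Proof.
move=> dh; rewrite -derive_grad //.
have dhv : derivable (h : _ -> R^o) x v by exact: diff_derivable.
have right0 : (0 : R)^'+ `=>` (0 : R)^'.
  move=> A [d d0 dA]; exists d => // r rd r0.
  by apply: dA => //; rewrite gt_eqF.
pose q (r : R) : R := r^-1 *: ((h \o shift x) (r *: v) - h x).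
have qx : q @ 0^' --> 'D_v h x by exact: dhv.
have -> : (fun t => (h (x + t *: v) - h x) / t) = q.
  by apply/funext => r; rewrite /q /= mulrC (addrC x).
by move=> B /qx; exact: right0.
Qed.

End Gradient.

(** * The regularized maximizers and their limits *)

Section MaxFunctionTheory.
Context {R : realType} {n m : nat}.
Context (Y : set 'rV[R]_m) (phi : 'rV[R]_n -> 'rV[R]_m -> R).
Hypothesis Y_neq0 : Y !=set0.
Hypothesis Ycompact : compact Y.
Hypothesis phi_diff : forall y, Y y ->
  forall x, differentiable ((fun z => phi z y) : 'rV[R]_n -> R^o) x.
Hypothesis phi_cont : {within [set: 'rV[R]_n] `*` Y,
  continuous (fun p : 'rV[R]_n * 'rV[R]_m => phi p.1 p.2)}.
Hypothesis gradx_cont : {within [set: 'rV[R]_n] `*` Y,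
  continuous (fun p : 'rV[R]_n * 'rV[R]_m => gradx phi p.1 p.2)}.

Section Limits.
Context (T : Type) (F : set_system T) {FF : Filter F}.
Context (x : T -> 'rV[R]_n) (y : T -> 'rV[R]_m).
Context (xbar : 'rV[R]_n) (ybar : 'rV[R]_m).
Hypotheses (Yybar : Y ybar) (x_cvg : x @ F --> xbar) (y_cvg : y @ F --> ybar).
Hypothesis Yy : \forall t \near F, Y (y t).

Lemma phi_cvg : phi (x t) (y t) @[t --> F] --> phi xbar ybar.
Proof.
apply: (within_continuous_cvg (p := fun t => (x t, y t)) (a := (xbar, ybar))
  _ phi_cont) => //.
- exact: cvg_pair x_cvg y_cvg.
- by apply: filterS Yy => t Yyt.
Qed.

Lemma gradx_cvg :
  gradx phi (x t) (y t) @[t --> F] --> gradx phi xbar ybar.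
Proof.
apply: (within_continuous_cvg (p := fun t => (x t, y t)) (a := (xbar, ybar))
  _ gradx_cont) => //.
- exact: cvg_pair x_cvg y_cvg.
- by apply: filterS Yy => t Yyt.
Qed.

Lemma objective_cvg (e : T -> R) (ebar : R) : e @ F --> ebar ->
  phi (x t) (y t) - e t / 2 * enorm (gradx phi (x t) (y t)) ^+ 2 @[t --> F]
    --> phi xbar ybar - ebar / 2 * enorm (gradx phi xbar ybar) ^+ 2.
Proof.
move=> e_cvg; apply: cvgB; first exact: phi_cvg.
apply: cvgM; first by apply: cvgMl.
under eq_fun do rewrite enorm_sqr.
by rewrite enorm_sqr; apply: dotv_cvg; exact: gradx_cvg.
Qed.

End Limits.

(** Optimality is a family of weak inequalities between jointly continuous
    expressions, hence it survives passage to the limit; [ebar] may be 0. *)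
Lemma Yeps_closed_graph (T : Type) (F : set_system T)
    (x : T -> 'rV[R]_n) (e : T -> R) (y : T -> 'rV[R]_m) xbar ebar ybar :
  ProperFilter F -> x @ F --> xbar -> e @ F --> ebar -> y @ F --> ybar ->
  (\forall t \near F, Yeps Y phi (x t) (e t) (y t)) ->
  Yeps Y phi xbar ebar ybar.
Proof.
move=> FF x_cvg e_cvg y_cvg Fy.
have FYy : \forall t \near F, Y (y t) by apply: filterS Fy => t [].
have Yybar : Y ybar.
  exact: closed_cvg (compact_closed (@norm_hausdorff _ _) Ycompact) FYy _ y_cvg.
split=> // w Yw.
have w_cvg : (fun=> w) @ F --> w by exact: cvg_cst.
have Yw_near : \forall t \near F, Y w by exact: filterE.
have w_lim := objective_cvg Yw x_cvg w_cvg Yw_near e_cvg.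
have y_lim := objective_cvg Yybar x_cvg y_cvg FYy e_cvg.
rewrite -subr_ge0; apply: (cvgr_to_ge (cvgB (y_lim _) (w_lim _))).
by apply: filterS Fy => t [_ ymax]; rewrite subr_ge0; exact: ymax.
Qed.

Lemma ultra_selection (T : Type) (U : set_system T)
    (x : T -> 'rV[R]_n) (y : T -> 'rV[R]_m) xbar :
  UltraFilter U -> x @ U --> xbar -> (\forall t \near U, Y (y t)) ->
  exists ybar, [/\ Y ybar, y @ U --> ybar,
    phi (x t) (y t) @[t --> U] --> phi xbar ybar
    & gradx phi (x t) (y t) @[t --> U] --> gradx phi xbar ybar].
Proof.
move=> UU x_cvg UYy.
have [ybar [Yybar y_cluster]] := @Ycompact (y @ U) _ UYy.
have y_cvg : y @ U --> ybar.
  move=> B ybarB; have [//|UnB] := in_ultra_setVsetC (y @^-1` B) UU.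
  by have [w [nBw Bw]] := y_cluster (~` B) B UnB ybarB; case: nBw.
by exists ybar; split => //; [exact: phi_cvg|exact: gradx_cvg].
Qed.

Lemma Yeps_ultra_limit (T : Type) (U : set_system T)
    (x : T -> 'rV[R]_n) (e : T -> R) (y : T -> 'rV[R]_m) xbar ebar :
  UltraFilter U -> x @ U --> xbar -> e @ U --> ebar ->
  (\forall t \near U, Yeps Y phi (x t) (e t) (y t)) ->
  exists ybar, [/\ Yeps Y phi xbar ebar ybar,
    phi (x t) (y t) @[t --> U] --> phi xbar ybar
    & gradx phi (x t) (y t) @[t --> U] --> gradx phi xbar ybar].
Proof.
move=> UU x_cvg e_cvg Uy.
have UYy : \forall t \near U, Y (y t) by apply: filterS Uy => t [].
have [ybar [Yybar y_cvg phi_c g_c]] := ultra_selection UU x_cvg UYy.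
by exists ybar; split => //; exact: Yeps_closed_graph Uy.
Qed.

Lemma Yeps0 x : Yeps Y phi x 0 = Ystar Y phi x.
Proof.
rewrite /Yeps /Ystar; congr argmax; apply/funext => y.
by rewrite mul0r mul0r subr0.
Qed.

Lemma Yeps_neq0 x e : Yeps Y phi x e !=set0.
Proof.
have [|y /set_mem Yy ymax] := compact_EVT_max (f := fun y =>
    phi x y - e / 2 * enorm (gradx phi x y) ^+ 2) Y_neq0 Ycompact.
  apply/subspace_continuousP => y Yy.
  apply: objective_cvg => //.
  - exact: cvg_cst.
  - exact: cvg_within.
  - exact: withinT.
  - exact: cvg_cst.
by exists y; split => // w /mem_set /ymax.
Qed.

Lemma Ystar_neq0 x : Ystar Y phi x !=set0.
Proof. by rewrite -Yeps0; exact: Yeps_neq0. Qed.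

Lemma maxfE x y : Ystar Y phi x y -> maxf Y phi x = phi x y.
Proof.
move=> [Yy ymax]; have ub : ubound [set phi x w | w in Y] (phi x y).
  by move=> _ [w Yw <-]; exact: ymax.
apply/le_anti/andP; split.
  by apply: ge_sup => //; exists (phi x y), y.
by apply: ub_le_sup; [exists (phi x y)|exists y].
Qed.

Lemma phi_le_maxf x y : Y y -> phi x y <= maxf Y phi x.
Proof.
move=> Yy; have [w w_opt] := Ystar_neq0 x.
by rewrite (maxfE w_opt); exact: w_opt.2.
Qed.

(** An active w has the larger value of phi x, so y can have the larger
    regularized value only through a smaller penalty. *)
Lemma Yeps_enorm_le x e y w : 0 < e -> Yeps Y phi x e y -> Ystar Y phi x w ->
  enorm (gradx phi x y) <= enorm (gradx phi x w).
Proof.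
move=> e0 [Yy ymax] [Yw wmax].
have := ymax _ Yw; have := wmax _ Yy => /= wy yw.
rewrite ler_enorm -!enorm_sqr -(ler_pM2l (_ : 0 < e / 2)) ?divr_gt0 //.
lra.
Qed.

(** * The Clarke subdifferential of the max function *)

Local Notation f := (maxf Y phi).

(** Already the difference quotients based at x itself are at least those of
    phi _ y, since f lies above phi _ y and equals it at x. *)
Lemma active_clarke x y : Ystar Y phi x y -> clarke f x (gradx phi x y).
Proof.
move=> y_opt v; have Yy := y_opt.1.
have slope := slope_line (v := v) (phi_diff Yy x).
apply: le_ereal_inf_tmp => _ [A [[P Q] /= [xP Q0] PQA] <-].
apply/lee_subgt0Pr => d d0; rewrite -EFinB.
have Fge : \forall t \near 0^'+, dotv (gradx phi x y) v - d <=
    (phi (x + t *: v) y - phi x y) / t.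
  by apply: (cvgr_ge _ slope); rewrite ltrBlDr ltrDl.
have [t [[tge Qt] t0]] :=
  filter_ex (filterI (filterI Fge Q0) (nbhs_right_gt (0 : R))).
apply: (@le_trans _ _ ((f (x + t *: v) - f x) / t)%:E).
  rewrite lee_fin (le_trans tge) // ler_pM2r ?invr_gt0 // (maxfE y_opt).
  by rewrite lerD2r; exact: phi_le_maxf.
apply: ereal_sup_ubound; exists (x, t) => //; apply: PQA; split => //.
exact: nbhs_singleton.
Qed.

(** Upper half of Danskin's theorem.  With y active at z + t v, the quotient
    (f (z + t v) - f z) / t is at most that of phi _ y, which by the mean value
    theorem is <grad_x phi (z + s v) y, v> for some s in ]0, t[; as z -> x and
    t -> 0, y accumulates at an index active at x. *)
Lemma clarke_dd_le x v c :
  (forall y, Ystar Y phi x y -> dotv (gradx phi x y) v <= c) ->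
  (clarke_dd f x v <= c%:E)%E.
Proof.
move=> le_c; apply/lee_addgt0Pr => d d0; rewrite -EFinD.
pose F := filter_prod (nbhs x) (0 : R)^'+.
pose q (p : 'rV[R]_n * R) := (f (p.1 + p.2 *: v) - f p.1) / p.2.
suff Fq : F [set p | q p <= c + d].
  apply: (@le_trans _ _
    (ereal_sup [set (q p)%:E | p in [set p | q p <= c + d]])).
    by apply: ereal_inf_lbound; exists [set p | q p <= c + d].
  by apply: ge_ereal_sup => _ [p /= qp <-]; rewrite lee_fin.
have [y y_opt] := choice (fun p : 'rV[R]_n * R => Ystar_neq0 (p.1 + p.2 *: v)).
have mean p : exists s, 0 < p.2 -> 0 < s < p.2 /\
    q p <= dotv (gradx phi (p.1 + s *: v) (y p)) v.
  have [p0|] := ltP 0 p.2; last by move=> p0; exists 0.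
  have [s s_p phi_s] := mvt_line p.1 v p0 (phi_diff (y_opt p).1).
  exists s => _; split => //; rewrite /q ler_pdivrMr // mulrC -phi_s.
  rewrite (maxfE (y_opt p)) lerD2l lerN2.
  exact/phi_le_maxf/(y_opt p).1.
have [s sP] := choice mean.
apply: near_ultra => U UU FU.
have U1 : fst @ U --> x by move=> B xB; apply: FU; exact: cvg_fst xB.
have U2 : snd @ U --> (0 : R)^'+ by move=> B xB; apply: FU; exact: cvg_snd xB.
have U0 : \forall p \near U, 0 < p.2 by exact: U2 (nbhs_right_gt (0 : R)).
have U2' : snd @ U --> (0 : R).
  by apply: cvg_trans U2 _; exact: cvg_within.
have s_cvg : s @ U --> (0 : R).
  apply: (squeeze_cvgr (f := fun=> 0) (h := snd)) => //; last exact: cvg_cst.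
  by apply: filterS U0 => p /sP[/andP[s0 sp] _]; rewrite !ltW.
have moved (r : 'rV[R]_n * R -> R) : r @ U --> (0 : R) ->
    p.1 + r p *: v @[p --> U] --> x.
  move=> r0; rewrite -[x]addr0 -(scale0r v).
  by apply: cvgD => //; apply: cvgZr_tmp.
have UYeps : \forall p \near U, Yeps Y phi (p.1 + p.2 *: v) 0 (y p).
  by apply: filterE => p; rewrite Yeps0.
have UYy : \forall p \near U, Y (y p).
  by apply: filterE => p; exact: (y_opt p).1.
have [ybar [Yybar y_cvg _ g_cvg]] := ultra_selection UU (moved _ s_cvg) UYy.
have ybar_opt : Ystar Y phi x ybar.
  rewrite -Yeps0.
  by apply: Yeps_closed_graph (moved _ U2') _ y_cvg UYeps; exact: cvg_cst.
have g_le : \forall p \near U,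
    dotv (gradx phi (p.1 + s p *: v) (y p)) v <= c + d.
  have dv_cvg : dotv (gradx phi (p.1 + s p *: v) (y p)) v @[p --> U]
      --> dotv (gradx phi x ybar) v by apply: dotv_cvg g_cvg _; exact: cvg_cst.
  apply: (cvgr_le _ dv_cvg).
  by rewrite (le_lt_trans (le_c _ ybar_opt)) // ltrDl.
by apply: filterS2 U0 g_le => p /sP[_ qp]; exact: le_trans.
Qed.

(** The bound is one more than a bound M' on the gradients at x itself, which
    form a compact set: along any ultrafilter with z -> x and y in Y, the
    gradient converges to one of these, so its norm is eventually below
    M' + 1. *)
Lemma gradx_locally_bounded (x : 'rV[R]_n) : exists2 M, 0 <= M &
  \forall z \near x, forall y, Y y -> `|gradx phi z y| <= M.
Proof.
have bnd : bounded_set [set gradx phi x y | y in Y].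
  apply: compact_bounded; apply: continuous_compact Ycompact.
  apply/subspace_continuousP => y Yy.
  apply: gradx_cvg => //; [exact: cvg_cst|exact: cvg_within|exact: withinT].
have [M [M_real Mbnd]] := bnd.
have [M' [M0 M'bnd]] : exists M', 0 <= M' /\
    forall y, Y y -> `|gradx phi x y| <= M'.
  exists (Num.max 0 (M + 1)); rewrite le_max lexx; split => // y Yy.
  rewrite le_max; apply/orP; right.
  apply: (Mbnd (M + 1)); first by rewrite ltrDl.
  by exists y.
exists (M' + 1); first by rewrite addr_ge0.
pose F := filter_prod (nbhs x) (globally Y).
have : F [set p | `|gradx phi p.1 p.2| <= M' + 1].
  apply: near_ultra => U UU FU.
  have U1 : fst @ U --> x by move=> B xB; apply: FU; exact: cvg_fst xB.
  have UY : \forall p \near U, Y p.2.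
    by apply: FU; exact: (cvg_snd (F := nbhs x) (G := globally Y)).
  have [y [Yy _ _ g_cvg]] := ultra_selection UU U1 UY.
  apply: (cvgr_norm_le _ g_cvg).
  by rewrite (le_lt_trans (M'bnd _ Yy)) // ltrDl.
move=> [[P Q] /= [xP YQ] PQ]; apply: filterS xP => z Pz y Yy.
by apply: (PQ (z, y)); split => //; exact: YQ.
Qed.

(** With y active at z, the increment f z - f z' is at most that of phi _ y,
    which the mean value theorem bounds by the gradients on the segment; the
    ball, being convex, contains that segment. *)
Lemma maxf_lipschitz : locally_lipschitz f.
Proof.
move=> x; have [M M0] := gradx_locally_bounded x.
move=> /nbhs_ballP[r r0 gM].
exists (ball x r); first exact: nbhsx_ballx.
have seg z z' c : ball x r z -> ball x r z' -> 0 < c < 1 ->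
    ball x r (z' + c *: (z - z')).
  rewrite -ball_normE /= => zr z'r /andP[c0 c1].
  have -> : x - (z' + c *: (z - z')) = c *: (x - z) + (1 - c) *: (x - z').
    rewrite scalerBl scale1r !scalerBr; apply/rowP => i; rewrite !mxE; ring.
  rewrite (le_lt_trans (ler_normD _ _)) // !normrZ.
  rewrite gtr0_norm // gtr0_norm ?subr_gt0 //.
  nra.
have one_sided z z' : ball x r z -> ball x r z' ->
    f z - f z' <= n%:R * M * `|z - z'|.
  move=> zr z'r; have [y y_opt] := Ystar_neq0 z.
  have Yy := y_opt.1.
  have [c c01 phi_c] := mvt_line z' (z - z') ltr01 (phi_diff Yy).
  rewrite scale1r subrKC mul1r in phi_c.
  apply: (@le_trans _ _ (phi z y - phi z' y)).
    by rewrite (maxfE y_opt) lerD2l lerN2; exact: phi_le_maxf.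
  rewrite phi_c (le_trans (dotv_le_norm _ _)) // ler_wpM2r // ler_wpM2l //.
  by apply: gM => //; exact: seg.
exists (n%:R * M); split; first exact: num_real.
move=> K MK [z z'] [/= zr z'r].
apply: (@le_trans _ _ (n%:R * M * `|z - z'|)); last by rewrite ler_wpM2r // ltW.
rewrite ler_norml one_sided // andbT lerNl opprB distrC.
exact: one_sided.
Qed.

(** * The regularized gradients *)

Lemma Geps0 x : Geps Y phi x 0 = activegrads Y phi x.
Proof. by rewrite /Geps Yeps0. Qed.

Lemma Geps_neq0 x e : Geps Y phi x e !=set0.
Proof. by have [y y_opt] := Yeps_neq0 x e; exists (gradx phi x y), y. Qed.

Lemma Geps_selection (T : Type) (x : T -> 'rV[R]_n) (e : T -> R)
    (u : T -> 'rV[R]_n) :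
  exists y : T -> 'rV[R]_m, forall t, Geps Y phi (x t) (e t) (u t) ->
    Yeps Y phi (x t) (e t) (y t) /\ gradx phi (x t) (y t) = u t.
Proof.
have sel t : exists w, Geps Y phi (x t) (e t) (u t) ->
    Yeps Y phi (x t) (e t) w /\ gradx phi (x t) w = u t.
  have [[w w_opt wu]|nG] := pselect (Geps Y phi (x t) (e t) (u t)).
    by exists w.
  (* Off the graph of G the selection is arbitrary. *)
  by exists 0.
by have [y yP] := choice sel; exists y.
Qed.

Lemma Geps_ultra_limit (T : Type) (U : set_system T)
    (x : T -> 'rV[R]_n) (e : T -> R) (u : T -> 'rV[R]_n) xbar ebar :
  UltraFilter U -> x @ U --> xbar -> e @ U --> ebar ->
  (\forall t \near U, Geps Y phi (x t) (e t) (u t)) ->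
  exists2 v, Geps Y phi xbar ebar v & u @ U --> v.
Proof.
move=> UU x_cvg e_cvg UG; have [y yP] := Geps_selection x e u.
have Uy : \forall t \near U, Yeps Y phi (x t) (e t) (y t).
  by apply: filterS UG => t /yP[].
have [ybar [ybar_opt _ g_cvg]] := Yeps_ultra_limit UU x_cvg e_cvg Uy.
exists (gradx phi xbar ybar); first by exists ybar.
apply: cvg_trans g_cvg; apply: near_eq_cvg.
by apply: filterS UG => t /yP[].
Qed.

Lemma Geps_closed_graph (T : Type) (F : set_system T)
    (x : T -> 'rV[R]_n) (e : T -> R) (u : T -> 'rV[R]_n) xbar ebar v :
  ProperFilter F -> x @ F --> xbar -> e @ F --> ebar -> u @ F --> v ->
  (\forall t \near F, Geps Y phi (x t) (e t) (u t)) -> Geps Y phi xbar ebar v.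
Proof.
move=> FF x_cvg e_cvg u_cvg FG; have [U [UU FU]] := ultraFilterLemma FF.
have [w wG u_cvg'] :=
  Geps_ultra_limit UU (cvg_finer FU x_cvg) (cvg_finer FU e_cvg) (FU _ FG).
by rewrite (cvg_unique (@norm_hausdorff _ _) (cvg_finer FU u_cvg) u_cvg').
Qed.

(** Taking e k -> 0 yields the joint outer limit in x and e, and taking e constant
    the outer limit in x alone. *)
Lemma Geps_outer_limit (x : nat -> 'rV[R]_n) (e : nat -> R) xbar ebar :
  x @ \oo --> xbar -> e @ \oo --> ebar ->
  outer_limit (fun k => Geps Y phi (x k) (e k)) `<=` Geps Y phi xbar ebar.
Proof.
move=> x_cvg e_cvg v [N [Ninf [u [Gu u_cvg]]]].
have NP := within_infinite_proper Ninf.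
apply: (Geps_closed_graph (F := within N \oo) (x := x) (e := e)) u_cvg _.
- exact: cvg_within_filter.
- exact: cvg_within_filter.
- by apply: (filterE (F := \oo)) => k; exact: Gu.
Qed.

Lemma Geps_closed x e : closed (Geps Y phi x e).
Proof.
move=> v v_cl; have vP := within_nbhs_proper v_cl.
apply: (Geps_closed_graph (F := within (Geps Y phi x e) (nbhs v))
  (x := fun=> x) (e := fun=> e) (u := id)).
- exact: cvg_cst.
- exact: cvg_cst.
- exact: cvg_within.
- exact: withinT.
Qed.

Lemma Geps_locally_bounded (x : 'rV[R]_n) e :
  exists2 V, nbhs x V & bounded_set (\bigcup_(z in V) Geps Y phi z e).
Proof.
have [M M0 gM] := gradx_locally_bounded x.
exists [set z | forall y, Y y -> `|gradx phi z y| <= M]; first exact: gM.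
exists M; split; first exact: num_real.
move=> K MK _ [z zM [y [Yy _] <-]].
by rewrite /= (le_trans (zM _ Yy)) // ltW.
Qed.

Lemma phi_Yeps_cvg (T : Type) (F : set_system T)
    (x : T -> 'rV[R]_n) (e : T -> R) (y : T -> 'rV[R]_m) xbar :
  Filter F -> x @ F --> xbar -> e @ F --> (0 : R) ->
  (\forall t \near F, Yeps Y phi (x t) (e t) (y t)) ->
  phi (x t) (y t) @[t --> F] --> f xbar.
Proof.
move=> FF x_cvg e_cvg Fy; apply: cvg_ultra => U UU FU.
have [ybar [ybar_opt phi_c _]] :=
  Yeps_ultra_limit UU (cvg_finer FU x_cvg) (cvg_finer FU e_cvg) (FU _ Fy).
by rewrite Yeps0 in ybar_opt; rewrite (maxfE ybar_opt).
Qed.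

Lemma limsup_eps_x_clarke (H : 'rV[R]_n -> R -> set 'rV[R]_n) xbar :
  (forall x e, 0 < e -> H x e `<=` Geps Y phi x e) ->
  limsup_eps_x H xbar `<=` clarke f xbar.
Proof.
move=> HG v [x [e [x_cvg e0 e_cvg [N [Ninf [u [Hu u_cvg]]]]]]].
have : Geps Y phi xbar 0 v.
  apply: (Geps_outer_limit x_cvg e_cvg); exists N; split => //.
  by exists u; split => // k Nk; apply: HG (Hu _ Nk).
by rewrite Geps0 => -[y y_opt <-]; exact: active_clarke.
Qed.

Lemma limsup_x_Geps (H : 'rV[R]_n -> set 'rV[R]_n) e xbar :
  (forall x, H x `<=` Geps Y phi x e) ->
  limsup_x H xbar `<=` Geps Y phi xbar e.
Proof.
move=> HG v [x x_cvg [N [Ninf [u [Hu u_cvg]]]]].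
apply: (Geps_outer_limit (e := fun=> e) x_cvg); first exact: cvg_cst.
exists N; split => //.
by exists u; split => // k Nk; apply: HG (Hu _ Nk).
Qed.

Lemma limsup_x_GepsE e x : limsup_x (Geps Y phi ^~ e) x = Geps Y phi x e.
Proof.
apply/seteqP; split; first by apply: limsup_x_Geps => z v.
exact: (limsup_x_ge (H := Geps Y phi ^~ e)).
Qed.

Lemma Geps_enorm_le x e v s : 0 < e -> Geps Y phi x e v ->
  activegrads Y phi x s -> enorm v <= enorm s.
Proof. by move=> e0 [y y_opt <-] [w w_opt <-]; exact: Yeps_enorm_le e0 _ _. Qed.

(** The limit s is active since the graph of G is closed up to e = 0, and the
    bound of each regularized gradient by every active one passes to the
    limit. *)
Lemma Geps_ultra_argmin (T : Type) (U : set_system T) (e : T -> R)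
    (u : T -> 'rV[R]_n) x :
  UltraFilter U -> e @ U --> (0 : R) -> (\forall t \near U, 0 < e t) ->
  (\forall t \near U, Geps Y phi x (e t) (u t)) ->
  exists2 s, argmin (activegrads Y phi x) enorm s & u @ U --> s.
Proof.
move=> UU e_cvg e0 UG; have x_cvg : (fun=> x) @ U --> x by exact: cvg_cst.
have [s] := Geps_ultra_limit UU x_cvg e_cvg UG; rewrite Geps0 => Ss u_cvg.
exists s => //; split => // w Sw; rewrite ler_enorm.
have uu_cvg : dotv (u t) (u t) @[t --> U] --> dotv s s by exact: dotv_cvg.
apply: (cvgr_to_le uu_cvg).
apply: filterS2 e0 UG => t et Gt.
by rewrite -ler_enorm; exact: Geps_enorm_le et Gt Sw.
Qed.

(** The minimizer is obtained as a limit of regularized gradients. *)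
Lemma activegrads_argmin x : argmin (activegrads Y phi x) enorm !=set0.
Proof.
have [u Gu] := choice (Geps_neq0 x).
have [U [UU rightU]] := ultraFilterLemma (at_right_proper_filter (0 : R)).
have e_cvg : id @ U --> (0 : R).
  by move=> B B0; apply: rightU; exact: (cvg_within _ B0).
have e0 : \forall e \near U, 0 < e by apply: rightU; exact: nbhs_right_gt.
have UG : \forall e \near U, Geps Y phi x e (u e) by exact: filterE.
by have [s s_min _] := Geps_ultra_argmin UU e_cvg e0 UG; exists s.
Qed.

(** * Convex sets of active gradients *)

Section ConvexActive.
Context (x : 'rV[R]_n) (s0 : 'rV[R]_n).
Hypothesis S_convex : convex_set (activegrads Y phi x).
Hypothesis s0_min : argmin (activegrads Y phi x) enorm s0.

(** Testing the definition of the Clarke subdifferential in the single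
    direction - s0 suffices, because convexity gives <s, s0> >= |s0|^2 for
    every active gradient s. *)
Lemma clarke_dotv_ge xi : clarke f x xi -> dotv s0 s0 <= dotv xi s0.
Proof.
move=> /(_ (- s0)) xi_le; rewrite -lerN2 -!dotvNr -lee_fin.
apply: le_trans xi_le _; apply: clarke_dd_le => y y_opt.
by rewrite !dotvNr lerN2; apply: convex_min_norm S_convex s0_min _; exists y.
Qed.

Lemma min_norm_subgradE : min_norm_subgrad f x = [set s0].
Proof.
have s0_clarke : clarke f x s0.
  by have [[y y_opt <-] _] := s0_min; exact: active_clarke.
apply/seteqP; split => [xi [xi_clarke xi_min]|_ ->] /=.
  by apply: eq_of_enorm_le (clarke_dotv_ge xi_clarke) _; exact: xi_min.
by split => // w /clarke_dotv_ge; exact: enorm_le_of_dotv.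
Qed.

Lemma Geps_cvg_min (T : Type) (F : set_system T) (e : T -> R)
    (u : T -> 'rV[R]_n) : Filter F ->
  e @ F --> (0 : R) -> (\forall t \near F, 0 < e t) ->
  (\forall t \near F, Geps Y phi x (e t) (u t)) -> u @ F --> s0.
Proof.
move=> FF e_cvg e0 FG; apply: cvg_ultra => U UU FU.
have [s [Ss s_min] u_cvg] :=
  Geps_ultra_argmin UU (cvg_finer FU e_cvg) (FU _ e0) (FU _ FG).
suff <- : s = s0 by [].
apply: eq_of_enorm_le; first exact: convex_min_norm S_convex s0_min Ss.
by apply: s_min; have [] := s0_min.
Qed.

End ConvexActive.

(** The family A can be G x itself or a single-valued selection of it. *)
Lemma set_cvg_min_norm x (A : R -> set 'rV[R]_n) :
  convex_set (activegrads Y phi x) ->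
  (forall e, 0 < e -> A e !=set0) ->
  (forall e, 0 < e -> A e `<=` Geps Y phi x e) ->
  set_cvg_eps A (min_norm_subgrad f x).
Proof.
move=> S_convex A_neq0 AG e e0 e_cvg.
have [s0 s0_min] := activegrads_argmin x.
rewrite (min_norm_subgradE S_convex s0_min).
apply: set_cvg_singleton => [k|N u Au]; first exact: A_neq0.
apply: (Geps_cvg_min S_convex s0_min (e := e)).
- exact: cvg_within_filter.
- exact: filterE.
- by apply: (filterE (F := \oo)) => k Nk; apply: AG => //; exact: Au.
Qed.

End MaxFunctionTheory.

Theorem lemma2 (R : realType) (n m : nat) (Y : set 'rV[R]_m)
  (phi : 'rV[R]_n -> 'rV[R]_m -> R)
  (Yconvex : convex_set Y) (Ycompact : compact Y)
  (phi_diff : forall y, Y y ->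
    forall x, differentiable ((fun z => phi z y) : 'rV[R]_n -> R^o) x)
  (phi_cont : {within [set: 'rV[R]_n] `*` Y,
    continuous (fun p : 'rV[R]_n * 'rV[R]_m => phi p.1 p.2)})
  (gradx_cont : {within [set: 'rV[R]_n] `*` Y,
    continuous (fun p : 'rV[R]_n * 'rV[R]_m => gradx phi p.1 p.2)})
  (phi_concave : forall x, convex_function Y (fun y => - phi x y))
  (yeps : R -> 'rV[R]_n -> 'rV[R]_m)
  (yepsP : forall x e, 0 < e -> Yeps Y phi x e (yeps e x)) :
  let f := maxf Y phi in
  let S := activegrads Y phi in
  let G := Geps Y phi in
  (forall xbar : 'rV[R]_n,
    [/\ (* (a) *)
        phi p.1 (yeps p.2 p.1)
          @[p --> filter_prod (nbhs xbar) (0 : R)^'+] --> f xbar,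
        (* (b) *)
        limsup_eps_x (fun x e => [set gradx phi x (yeps e x)]) xbar
          `<=` clarke f xbar /\
        limsup_eps_x G xbar `<=` clarke f xbar,
        (* (c) *)
        (forall e, 0 < e ->
          limsup_x (fun x => [set gradx phi x (yeps e x)]) xbar
            `<=` [set gradx phi xbar y | y in Yeps Y phi xbar e]) /\
        (forall e, 0 < e -> limsup_x (fun x => G x e) xbar = G xbar e)
      & (* (d) *)
        convex_set (S xbar) ->
          set_cvg_eps (fun e => [set gradx phi xbar (yeps e xbar)])
            (min_norm_subgrad f xbar) /\
          set_cvg_eps (fun e => G xbar e) (min_norm_subgrad f xbar)]) /\
  ((forall x, convex_set (S x)) -> descent_oriented f G).
Proof.
move=> f S G.
have Y_neq0 : Y !=set0 by exists (yeps 1 0); have [] := yepsP 0 1 ltr01.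
have yepsG x e : 0 < e -> [set gradx phi x (yeps e x)] `<=` G x e.
  by move=> e0 _ ->; exists (yeps e x) => //; exact: yepsP.
have cvg_min := set_cvg_min_norm Y_neq0 Ycompact phi_diff phi_cont gradx_cont.
have cvg_G x : convex_set (S x) ->
    set_cvg_eps (fun e => G x e) (min_norm_subgrad f x).
  move=> Sx_convex; apply: cvg_min => // e _; first exact: Geps_neq0.
  by [].
split=> [x|S_convex].
  split.
  - apply: (phi_Yeps_cvg Ycompact phi_cont gradx_cont
      (x := fst) (e := snd)).
    + exact: cvg_fst.
    + by move=> B B0; apply: (cvg_snd (F := nbhs x)); exact: cvg_within.
    + exists (setT, [set e | 0 < e]) => /=; last by move=> p [_ /yepsP].
      by split; [exact: filterT|exact: nbhs_right_gt].
  - by split; apply: limsup_eps_x_clarke => // z e e0 v.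
  - split => e e0; last exact: limsup_x_GepsE.
    by apply: limsup_x_Geps => // z; exact: yepsG.
  - move=> Sx_convex; split; last exact: cvg_G.
    apply: cvg_min => // e e0.
    + by exists (gradx phi x (yeps e x)).
    + exact: yepsG.
apply: DescentOriented => [|e _ x|e _ x|x|x].
- exact: maxf_lipschitz.
- exact: Geps_closed.
- exact: Geps_locally_bounded.
- by apply: limsup_eps_x_clarke => // z e _ v.
- apply: eq_set_cvg_eps (cvg_G x (S_convex x)) => e e0.
  by rewrite (limsup_x_GepsE Ycompact phi_cont gradx_cont).
Qed.
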